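(* Let $R$ be an associative algebra with unity over an infinite field $F$, and let $\nabla(R)$ be the $FC$-subring of $R$. Then: 1. any unit of $R$ that is algebraic over $F$ belongs to the centralizer of $\nabla(R)$ in $R$; 2. if $R$ is generated (as an $F$-algebra) by units that are algebraic over $F$, then $\nabla(R)$ is contained in the center of $R$.
   Context: $U(R)$ denotes the group of units of $R$. For $a\in R$, $C_{U(R)}(a)=\{u\in U(R)\mid ua=au\}$. The $FC$-subring of $R$ is $\nabla(R)=\{a\in R\mid [U(R):C_{U(R)}(a)]<\infty\}$. *)

(* Defs.v *)
From mathcomp Require Import all_boot all_algebra.
From mathcomp Require Import boolp classical_sets functions cardinality.

Set Implicit Arguments.
Unset Strict Implicit.
Unset Printing Implicit Defensive.

Import GRing.Theory.
Local Open Scope classical_set_scope.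
Local Open Scope ring_scope.

Definition units (R : unitRingType) : set R := [set u | u \is a GRing.unit].
Arguments units : clear implicits.

Definition centralizer (R : nzRingType) (S : set R) : set R :=
  [set x | forall s, S s -> GRing.comm x s].

Definition center (R : nzRingType) : set R := centralizer [set: R].
Arguments center : clear implicits.

Definition unit_centralizer (R : unitRingType) (a : R) : set R :=
  units R `&` [set u | GRing.comm u a].

(* Meant for subgroups [H `<=` G] of the unit group: the family of left cosets
   [u H], [u] in [G], is finite. *)
Definition finite_index (R : unitRingType) (G H : set R) : Prop :=
  finite_set [set [set u * h | h in H] | u in G].

Definition FC_subring (R : unitRingType) : set R :=
  [set a | finite_index (units R) (unit_centralizer a)].
Arguments FC_subring : clear implicits.

(* [algebraicOver] is only available for extensions of fields. *)
Definition algebraic_over (F : fieldType) (A : algType F) (a : A) : Prop :=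
  exists2 p : {poly F}, p != 0 & horner_alg a p = 0.

Definition generated_subalg (F : fieldType) (A : algType F) (S : set A) :
    set A :=
  smallest (fun B : set A => GRing.subalg_closed (mem B)) S.

(* Main.v *)
Require Import Defs.
From mathcomp Require Import all_boot all_algebra.
From mathcomp Require Import boolp classical_sets functions cardinality.

Set Implicit Arguments.
Unset Strict Implicit.
Unset Printing Implicit Defensive.

Import GRing.Theory.
Local Open Scope classical_set_scope.
Local Open Scope ring_scope.

(** Let [a] be in the FC-subring and let [u] be algebraic, killed by a nonzero
    polynomial [p].  Any scalar [c] that is not a root of [p] makes [u - c%:A]
    a unit ([unit_subr_alg]): dividing [p] by ['X - c] and evaluating at [u]
    shows that the product of [u - c%:A] with a polynomial in [u] is the
    nonzero scalar [- p.[c]].  Over an infinite field there are infinitely many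
    such [c] ([infinite_nonroots]), whereas the units commuting with [a] have
    finitely many cosets, so that two of these units share a coset
    ([finite_index_collision]):
    [u - c%:A = (u - d%:A) * h] with [c != d] and [h] commuting with [a].
    Since [u - c%:A] and [u - d%:A] differ by a nonzero scalar, the inverse of
    [u - d%:A] is an affine function of [h]; hence it commutes with [a], and so
    do [u - d%:A] and [u] ([comm_of_coset_translate]).

    The second part follows because the elements commuting with a given [a]
    form a subalgebra ([comm_subalg_closed]): if it contains the generators,
    it is the whole algebra. *)

(** Pigeonhole: otherwise [x |-> f x H] would embed the infinite index set [P]
    into the finite family of cosets. *)
Lemma finite_index_collision (R : unitRingType) (T : Type) (G H : set R)
    (P : set T) (f : T -> R) :
  finite_index G H -> H 1 -> infinite_set P -> (forall x, P x -> G (f x)) ->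
  exists x y, [/\ P y, x <> y & exists2 h, H h & f x = f y * h].
Proof.
move=> finGH H1 infP PG; apply: contrapT => noColl; apply: infP.
pose coset x := [set f x * h | h in H].
have coset_inj : set_inj P coset.
  move=> x y _ /set_mem Py eq_xy; apply: contrapT => neq_xy; apply: noColl.
  exists x, y; split=> //.
  have : coset x (f x) by exists 1; rewrite ?mulr1.
  by rewrite eq_xy => -[h Hh <-]; exists h.
rewrite -(eq_finite_set (inj_card_eq coset_inj)).
apply: sub_finite_set finGH => _ [x Px <-].
by exists (f x) => //; apply: PG.
Qed.

Lemma infinite_nonroots (F : fieldType) (p : {poly F}) :
  infinite_set [set: F] -> p != 0 -> infinite_set [set c | ~~ root p c].
Proof.
move=> infF p_neq0 finN.
have [B BR leB] := infinite_set_fset (size p) (infinite_setD infF finN).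
have /(max_poly_roots p_neq0) : all (root p) (finmap.enum_fset B).
  by apply/allP => c cB; have [_ /= /negP] := BR c cB; rewrite negbK.
by move=> /(_ (finmap.fset_uniq B)); rewrite ltnNge leB.
Qed.

Lemma unit_subr_alg (F : fieldType) (R : unitAlgType F) (u : R) (p : {poly F})
    (c : F) :
  horner_alg u p = 0 -> ~~ root p c -> u - c%:A \is a GRing.unit.
Proof.
move=> pu0 pc_neq0.
have /factor_theorem[q /(canRL (subrK _)) Dp] : root (p - p.[c]%:P) c.
  by rewrite /root !hornerE subrr.
have quE : horner_alg u q * (u - c%:A) = (- p.[c])%:A.
  have /esym/eqP := congr1 (horner_alg u) Dp.
  rewrite pu0 rmorphD rmorphM rmorphB /= !horner_algC horner_algX.
  by rewrite addr_eq0 scaleNr => /eqP.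
(* [R] is not commutative, but both factors are values at [u] of polynomials
   over the commutative ring [F], so they commute. *)
have uqE : (u - c%:A) * horner_alg u q = (- p.[c])%:A.
  by rewrite -quE -[u in u - _](horner_algX u) -(horner_algC u c) -rmorphB
             -!rmorphM mulrC.
have pcV : - p.[c] != 0 by rewrite oppr_eq0.
apply/unitrP; exists ((- p.[c])^-1 *: horner_alg u q); split.
  by rewrite -scalerAl quE scalerA mulVf ?scale1r.
by rewrite -scalerAr uqE scalerA mulVf ?scale1r.
Qed.

(** Writing [v = u - d%:A], the hypothesis reads [v * (h - 1) = (d - c)%:A],
    so that [v^-1] is a scalar multiple of [h - 1]. *)
Lemma comm_of_coset_translate (F : fieldType) (R : unitAlgType F)
    (u a h : R) (c d : F) :
  c != d -> u - d%:A \is a GRing.unit -> GRing.comm h a ->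
  u - c%:A = (u - d%:A) * h -> GRing.comm u a.
Proof.
move=> neq_cd Uv ha eq_h; set v := u - d%:A in Uv eq_h *.
have e_neq0 : d - c != 0 by rewrite subr_eq0 eq_sym.
have vhE : v * (h - 1) = (d - c)%:A.
  by rewrite mulrBr mulr1 -eq_h /v opprB addrC addrA subrK scalerBl.
have vV : v^-1 = (d - c)^-1 *: (h - 1).
  apply: (mulrI Uv).
  by rewrite divrr // -scalerAr vhE scalerA mulVf ?scale1r.
have aVv : GRing.comm a v^-1.
  rewrite vV /GRing.comm -scalerAr -scalerAl; congr (_ *: _).
  by apply: commrB; [apply: commr_sym | apply: commr1].
apply: commr_sym; rewrite -(subrK d%:A u); apply: commrD.
  by rewrite -/v -(invrK v); apply: commrV.
exact/commr_sym/comm_alg.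
Qed.

Lemma algebraic_comm_FC (F : fieldType) (R : unitAlgType F) (u : R) :
  infinite_set [set: F] -> algebraic_over u -> centralizer (FC_subring R) u.
Proof.
move=> infF [p p_neq0 pu0] a FCa.
have C1 : unit_centralizer a 1.
  by split; [apply: unitr1 | apply/commr_sym/commr1].
have Uu c : ~~ root p c -> units R (u - c%:A).
  exact: unit_subr_alg pu0.
have [c [d [/= pd_neq0 /eqP neq_cd [h [_ ha] eq_h]]]] :=
  finite_index_collision FCa C1 (infinite_nonroots infF p_neq0) Uu.
exact: comm_of_coset_translate neq_cd (Uu d pd_neq0) ha eq_h.
Qed.

Lemma comm_subalg_closed (F : fieldType) (A : algType F) (a : A) :
  GRing.subalg_closed (mem [set x | GRing.comm a x]).
Proof.
split=> [|k x y|x y]; first by rewrite inE; apply: commr1.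
  rewrite !inE => ax ay; apply: commrD => //.
  by rewrite /GRing.comm -scalerAr -scalerAl; congr (_ *: _).
by rewrite !inE => ax ay; apply: commrM.
Qed.

Theorem theorem3 (F : fieldType) (R : unitAlgType F)
    (Finf : infinite_set [set: F]) :
  (forall u : R, u \is a GRing.unit -> algebraic_over u ->
     centralizer (FC_subring R) u) /\
  (forall S : set R,
     (forall u : R, S u -> u \is a GRing.unit /\ algebraic_over u) ->
     generated_subalg S = [set: R] ->
     FC_subring R `<=` center R).
Proof.
split=> [u _ u_alg|S S_alg genS a FCa x _]; first exact: algebraic_comm_FC.
have : generated_subalg S x by rewrite genS.
apply: smallest_sub x; first exact: comm_subalg_closed.
by move=> u /S_alg[_ u_alg]; apply/commr_sym/algebraic_comm_FC.
Qed.
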